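(* Let $\vec r(t)=(x(t),y(t),z(t))$, $t_0<t<t_1$, be a simple curve of class $C^3$ in $\mathbb{R}^3$ with $(\vec r'(t)\wedge\vec r''(t))\cdot\vec r'''(t)\neq0$ for all $t\in(t_0,t_1)$. Fix $t\in(t_0,t_1)$, let $P=\vec r(t)$, and for sufficiently small $\Delta t>0$ let $Q=Q(\Delta t)=\vec r(t+\Delta t)$ be a point on the curve near $P$. Put $f_1(\Delta t)=x(t+\Delta t)-x(t)$, $f_2(\Delta t)=y(t+\Delta t)-y(t)$, $f_3(\Delta t)=z(t+\Delta t)-z(t)$, and $\mathcal{D}_P=|\overrightarrow{PQ}|$. Then $$\frac{d\mathcal{D}_P}{d\Delta t}=\frac{f_1(\Delta t)x'(t+\Delta t)+f_2(\Delta t)y'(t+\Delta t)+f_3(\Delta t)z'(t+\Delta t)}{\sqrt{f_1^2(\Delta t)+f_2^2(\Delta t)+f_3^2(\Delta t)}},\quad \Delta t>0;$$ $$\mathcal{D}_{P+}'(0)=\sqrt{x'^2(t)+y'^2(t)+z'^2(t)}.$$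
   Context: $\wedge$ and $\cdot$ are the cross product and dot product. $\mathcal{D}_P(0)=0$ and $\mathcal{D}_{P+}'(0)=\lim_{\Delta t\to0^+}\frac{\mathcal{D}_P(\Delta t)-\mathcal{D}_P(0)}{\Delta t}$ is the right derivative at $0$. *)

(* Defs.v *)
From Stdlib Require Import Reals.
From Coquelicot Require Import Coquelicot.
Open Scope R_scope.

Definition vec3 : Type := (R * R * R)%type.

Definition vsub (u v : vec3) : vec3 :=
  let '(u1, u2, u3) := u in
  let '(v1, v2, v3) := v in
  (u1 - v1, u2 - v2, u3 - v3).

Definition dot (u v : vec3) : R :=
  let '(u1, u2, u3) := u in
  let '(v1, v2, v3) := v in
  u1 * v1 + u2 * v2 + u3 * v3.

Definition cross (u v : vec3) : vec3 :=
  let '(u1, u2, u3) := u in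
  let '(v1, v2, v3) := v in
  (u2 * v3 - u3 * v2, u3 * v1 - u1 * v3, u1 * v2 - u2 * v1).

Definition enorm (v : vec3) : R := sqrt (dot v v).

Definition curve (x y z : R -> R) (t : R) : vec3 := (x t, y t, z t).

Definition curve_derive_n (x y z : R -> R) (n : nat) (t : R) : vec3 :=
  (Derive_n x n t, Derive_n y n t, Derive_n z n t).

(* All orders [k <= n] are required explicitly: [ex_derive_n f n s] alone says
   that the total function [Derive_n f (n - 1)] is differentiable at [s], which
   does not give differentiability at the lower orders. *)
Definition Cn_on (n : nat) (f : R -> R) (a b : R) : Prop :=
  forall (k : nat) (s : R), (k <= n)%nat -> a < s < b ->
    ex_derive_n f k s /\ continuous (Derive_n f k) s.

Definition curve_Cn (n : nat) (x y z : R -> R) (a b : R) : Prop :=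
  Cn_on n x a b /\ Cn_on n y a b /\ Cn_on n z a b.

Definition simple_curve (r : R -> vec3) (a b : R) : Prop :=
  forall s1 s2 : R, a < s1 < b -> a < s2 < b -> r s1 = r s2 -> s1 = s2.

Definition chord_length (r : R -> vec3) (t dt : R) : R :=
  enorm (vsub (r (t + dt)) (r t)).

Lemma chord_length_0 (r : R -> vec3) (t : R) : chord_length r t 0 = 0.
Proof.
  unfold chord_length, enorm.
  rewrite Rplus_0_r.
  destruct (r t) as [[a b] c]; simpl.
  replace (_ + _ + _) with 0 by ring.
  exact sqrt_0.
Qed.

Definition is_right_derive (f : R -> R) (a l : R) : Prop :=
  filterlim (fun h : R => (f (a + h) - f a) / h) (at_right 0) (locally l).

(* Main.v *)
(** The squared chord is positive for [dt > 0] because the curve is simple, so the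
    chain rule applies to its square root.  At [0] the squared chord vanishes and
    the square root is not differentiable; there one uses
    [|PQ| / dt = sqrt ((f1/dt)^2 + (f2/dt)^2 + (f3/dt)^2)] for [dt > 0], whose
    right-hand side converges by continuity of the norm. *)

Require Import Defs.
From Stdlib Require Import Reals.
From Stdlib Require Import Lra Lia.
From Coquelicot Require Import Coquelicot.
Open Scope R_scope.

Lemma Cn_on_ex_derive (n : nat) (f : R -> R) (a b s : R) :
  (1 <= n)%nat -> Cn_on n f a b -> a < s < b -> ex_derive f s.
Proof. intros Hn Hf Hs. exact (proj1 (Hf 1%nat s Hn Hs)). Qed.

Lemma enorm_pow (a b c : R) : enorm (a, b, c) = sqrt (a ^ 2 + b ^ 2 + c ^ 2).
Proof. unfold enorm, dot. f_equal. ring. Qed.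

Lemma sum_sq_pos (a b c : R) : (a, b, c) <> (0, 0, 0) -> 0 < a ^ 2 + b ^ 2 + c ^ 2.
Proof.
  intros H.
  destruct (Rle_lt_dec (a ^ 2 + b ^ 2 + c ^ 2) 0) as [Hle|]; [exfalso|assumption].
  apply H. repeat f_equal; nra.
Qed.

(** The sign of [h] matters: [sqrt (h ^ 2)] is [h] only for [h >= 0]. For [h < 0] the quotient would
    change sign, hence a one-sided derivative at [0]. *)
Lemma enorm_div (a b c h : R) :
  0 < h -> enorm (a, b, c) / h = enorm (a / h, b / h, c / h).
Proof.
  intros Hh. rewrite !enorm_pow.
  replace ((a / h) ^ 2 + (b / h) ^ 2 + (c / h) ^ 2)
    with ((a ^ 2 + b ^ 2 + c ^ 2) / h ^ 2) by (field; lra).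
  rewrite sqrt_div_alt by (apply pow_lt; exact Hh).
  now rewrite sqrt_pow2 by lra.
Qed.

(** The norm is [sqrt] of a polynomial, and [sqrt] is continuous even at [0]. The filter is left
    general so that [at_right 0] can be taken. *)
Lemma filterlim_enorm {T : Type} (F : (T -> Prop) -> Prop) {FF : Filter F}
  (u v w : T -> R) (a b c : R) :
  filterlim u F (locally a) -> filterlim v F (locally b) ->
  filterlim w F (locally c) ->
  filterlim (fun h => enorm (u h, v h, w h)) F (locally (enorm (a, b, c))).
Proof.
  intros Hu Hv Hw. unfold enorm, dot.
  assert (Hsq : forall (p : T -> R) (l : R), filterlim p F (locally l) ->
            filterlim (fun h => p h * p h) F (locally (l * l))).
  { intros p l Hp.
    exact (filterlim_comp_2 p p Rmult Hp Hp (@filterlim_mult R_AbsRing l l)). }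
  apply (filterlim_comp _ _ _ _ sqrt F (locally (a * a + b * b + c * c))).
  2: apply continuous_sqrt.
  refine (filterlim_comp_2 _ _ Rplus _ (Hsq w c Hw)
            (@filterlim_plus R_AbsRing R_NormedModule (a * a + b * b) (c * c))).
  exact (filterlim_comp_2 _ _ Rplus (Hsq u a Hu) (Hsq v b Hv)
           (@filterlim_plus R_AbsRing R_NormedModule (a * a) (b * b))).
Qed.

Lemma is_derive_is_right_derive (f : R -> R) (a l : R) :
  is_derive f a l -> is_right_derive f a l.
Proof.
  intros Hf. apply is_derive_Reals in Hf.
  apply filterlim_locally. intros eps.
  destruct (Hf eps (cond_pos eps)) as [d Hd].
  exists d. intros h Hh Hpos.
  (* The punctured condition [h <> 0] follows from [0 < h]. *)
  apply Hd; [lra|].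
  change (Rabs (h - 0) < d) in Hh. now rewrite Rminus_0_r in Hh.
Qed.

Lemma is_derive_chord_length (x y z : R -> R) (t dt : R) :
  ex_derive x (t + dt) -> ex_derive y (t + dt) -> ex_derive z (t + dt) ->
  curve x y z (t + dt) <> curve x y z t ->
  is_derive (chord_length (curve x y z) t) dt
    (((x (t + dt) - x t) * Derive x (t + dt) + (y (t + dt) - y t) * Derive y (t + dt)
        + (z (t + dt) - z t) * Derive z (t + dt))
     / sqrt ((x (t + dt) - x t) ^ 2 + (y (t + dt) - y t) ^ 2 + (z (t + dt) - z t) ^ 2)).
Proof.
  intros Hx Hy Hz Hne.
  assert (Hpos : 0 < (x (t + dt) - x t) ^ 2 + (y (t + dt) - y t) ^ 2
                     + (z (t + dt) - z t) ^ 2).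
  { apply sum_sq_pos. intros H. injection H as H1 H2 H3.
    apply Hne. unfold curve.
    now rewrite (Rminus_diag_uniq _ _ H1), (Rminus_diag_uniq _ _ H2),
      (Rminus_diag_uniq _ _ H3). }
  (* With the chord as an explicit [sqrt], [auto_derive] can differentiate it. *)
  apply (is_derive_ext (fun h => sqrt ((x (t + h) - x t) ^ 2 + (y (t + h) - y t) ^ 2
                                       + (z (t + h) - z t) ^ 2))).
  { intros h. symmetry. apply enorm_pow. }
  auto_derive.
  - repeat split; assumption.
  - change (fun s => x s) with x. change (fun s => y s) with y.
    change (fun s => z s) with z.
    (* The factor 2 from the squares cancels the one in [1 / (2 * sqrt _)]. Unfolding gives the
       radicand the same form in [Hpos] and in the goal, so [lra] can discharge the nonzero
       denominator. *)
    apply sqrt_lt_R0 in Hpos. unfold Rminus in *. simpl in *. field. lra.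
Qed.

Lemma is_right_derive_chord_length (x y z : R -> R) (t : R) :
  ex_derive x t -> ex_derive y t -> ex_derive z t ->
  is_right_derive (chord_length (curve x y z) t) 0
    (enorm (Derive x t, Derive y t, Derive z t)).
Proof.
  intros Hx Hy Hz.
  apply (filterlim_ext_loc (fun h => enorm
           ((x (t + h) - x t) / h, (y (t + h) - y t) / h, (z (t + h) - z t) / h))).
  (* The radius 1 is arbitrary: the two quotients agree for every [h > 0]. *)
  - exists (mkposreal 1 Rlt_0_1). intros h _ Hh.
    rewrite chord_length_0, Rminus_0_r, Rplus_0_l.
    symmetry. now apply enorm_div.
  - apply (filterlim_enorm (at_right 0)); apply is_derive_is_right_derive, Derive_correct; assumption.
Qed.

Theorem proposition3p4 (x y z : R -> R) (t0 t1 : R)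
  (hC3 : curve_Cn 3 x y z t0 t1)
  (hsimple : simple_curve (curve x y z) t0 t1)
  (htriple : forall s : R, t0 < s < t1 ->
     dot (cross (curve_derive_n x y z 1 s) (curve_derive_n x y z 2 s))
         (curve_derive_n x y z 3 s) <> 0)
  (t : R) (ht : t0 < t < t1) :
  let D := chord_length (curve x y z) t in
  let f1 := fun dt : R => x (t + dt) - x t in
  let f2 := fun dt : R => y (t + dt) - y t in
  let f3 := fun dt : R => z (t + dt) - z t in
  (forall dt : R, 0 < dt -> t + dt < t1 ->
     is_derive D dt
       ((f1 dt * Derive x (t + dt) + f2 dt * Derive y (t + dt)
           + f3 dt * Derive z (t + dt))
        / sqrt (f1 dt ^ 2 + f2 dt ^ 2 + f3 dt ^ 2))) /\
  is_right_derive D 0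
    (sqrt (Derive x t ^ 2 + Derive y t ^ 2 + Derive z t ^ 2)).
Proof.
  intros D f1 f2 f3.
  destruct hC3 as (hx & hy & hz).
  assert (Hd : forall f s, Cn_on 3 f t0 t1 -> t0 < s < t1 -> ex_derive f s).
  { intros f s. apply Cn_on_ex_derive. lia. }
  split.
  - intros dt Hdt Ht1.
    assert (Hs : t0 < t + dt < t1) by lra.
    apply is_derive_chord_length; auto.
    (* If [Q = P], simplicity would give [t + dt = t], against [0 < dt]. *)
    intros Heq. apply hsimple in Heq; lra.
  - rewrite <- enorm_pow. apply is_right_derive_chord_length; auto.
Qed.
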